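(* For every integer $r\ge 3$, the value $\frac{r-2}{r-1}$ is an accumulation point of the set of real numbers $$\Delta_{\mathrm{hom}}^{(r)}:=\{\delta_{\mathrm{hom}}(H): H \text{ a graph with } \chi(H)=r\}.$$
   Context: All graphs are finite and simple. A graph is $H$-free if it contains no (not necessarily induced) subgraph isomorphic to $H$. $\delta(G)$ denotes minimum degree and $\chi$ the chromatic number. The homomorphism threshold of a graph $H$, denoted $\delta_{\mathrm{hom}}(H)$, is the infimum of all $\gamma\ge 0$ for which there exists a (finite) $H$-free graph $F=F(\gamma,H)$ such that every $H$-free graph $G$ with $\delta(G)\ge\gamma|V(G)|$ admits a graph homomorphism to $F$. *)

(* Defs.v *)
From HB Require Import structures.
From mathcomp Require Import all_boot all_order all_algebra.
From mathcomp Require Import all_classical all_reals all_analysis.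

Set Implicit Arguments.
Unset Strict Implicit.
Unset Printing Implicit Defensive.

Import Order.TTheory GRing.Theory Num.Theory.
Import numFieldNormedType.Exports.

Local Open Scope classical_set_scope.
Local Open Scope ring_scope.

Record graph := Graph {
  vertex :> finType;
  adj : rel vertex;
  adj_sym : symmetric adj;
  adj_irr : irreflexive adj
}.

Definition is_hom (G F : graph) (f : G -> F) : Prop :=
  forall x y : G, adj x y -> adj (f x) (f y).

Definition hom_to (G F : graph) : Prop := exists f : G -> F, is_hom f.

(* A copy of H in G as a not necessarily induced subgraph: the image of H
   under an injective homomorphism. *)
Definition contains (G H : graph) : Prop :=
  exists f : H -> G, injective f /\ is_hom f.

Definition subgraph_free (H G : graph) : Prop := ~ contains G H.

Definition degree (G : graph) (x : G) : nat := #|[pred y | adj x y]|.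

(* The default #|G| of the iterated minimum exceeds every degree, so it only
   matters when G has no vertex, where it gives 0. *)
Definition min_degree (G : graph) : nat :=
  \big[minn/#|G|]_(x : G) degree x.

Definition colorable (G : graph) (k : nat) : bool :=
  [exists c : {ffun G -> 'I_k},
    [forall x : G, [forall y : G, adj x y ==> (c x != c y)]]].

Lemma colorable_card (G : graph) : colorable G #|G|.
Proof.
apply/existsP; exists [ffun x => enum_rank x].
apply/forallP=> x; apply/forallP=> y; apply/implyP=> xy; rewrite !ffunE.
by apply: contraTneq xy => /enum_rank_inj->; rewrite adj_irr.
Qed.

Definition chromatic_number (G : graph) : nat :=
  ex_minn (ex_intro (fun k => colorable G k) #|G| (colorable_card G)).

Definition hom_bounds (R : realType) (H : graph) : set R :=
  [set gamma : R | 0 <= gamma /\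
    exists F : graph, subgraph_free H F /\
      forall G : graph, subgraph_free H G ->
        gamma * #|G|%:R <= (min_degree G)%:R -> hom_to G F].
Arguments hom_bounds : clear implicits.

(* inf is a genuine infimum here as soon as H has a vertex: see
   has_inf_hom_bounds below. *)
Definition delta_hom (R : realType) (H : graph) : R := inf (hom_bounds R H).

Definition Delta_hom (R : realType) (r : nat) : set R :=
  [set x : R | exists H : graph, chromatic_number H = r /\ delta_hom R H = x].
Arguments Delta_hom : clear implicits.

Lemma min_degree_lt (G : graph) (x : G) : (min_degree G < #|G|)%N.
Proof.
have min_le : (min_degree G <= degree x)%N.
  rewrite /min_degree; elim: (index_enum G) (mem_index_enum x) => //= y s IHs.
  rewrite inE big_cons geq_min => /predU1P[->|/IHs->]; first by rewrite leqnn.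
  by rewrite orbT.
apply: leq_ltn_trans min_le _.
apply/proper_card/properP; split; first exact/fintype.subsetP.
by exists x; rewrite ?inE ?adj_irr.
Qed.

Lemma has_inf_hom_bounds (R : realType) (H : graph) :
  (0 < #|H|)%N -> has_inf (hom_bounds R H).
Proof.
move=> /card_gt0P[h _]; split; last by exists 0 => g [].
have sym0 : symmetric (fun _ _ : void => false) by [].
have irr0 : irreflexive (fun _ : void => fun _ : void => false) by [].
exists 1; split=> //; exists (Graph sym0 irr0); split.
  by case=> f _; case: (f h).
move=> G _; rewrite mul1r ler_nat leqNgt => GG.
have G0 (x : G) : False by rewrite (min_degree_lt x) in GG.
by exists (fun x => match G0 x with end) => x; case: (G0 x).
Qed.

(* Main.v *)
(** Let [A] be the complete [r]-partite graph with classes of size [r], and let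
[H] be [A] with isolated vertices added, up to [k + 1] vertices in total. A graph
is [H]-free exactly when it is [A]-free or has at most [k] vertices. Since [K_k]
is [H]-free and contains [A], a target [F] that works for [H] at a level below
[1 - 1/k] has at most [k] vertices, so [delta_hom H] exceeds
[c = (r - 2) / (r - 1)] once some [A]-free graph with minimum degree more than [c]
times its order is not [k]-colorable: the join of [r - 1] copies of a [C_4]-free
graph without isolated vertices that is not [k]-colorable is such a graph.
Conversely, by the Erdos-Stone theorem, [A]-free graphs with relative minimum
degree at least [c + e] have bounded order, so for [k] large the target [K_k]
shows [delta_hom H <= c + e]. *)

Require Import Defs.
From mathcomp Require Import all_boot all_order all_algebra.
From mathcomp Require Import all_classical all_reals all_analysis.
From mathcomp Require Import zify ring lra.
Import Order.TTheory GRing.Theory Num.Theory.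
Import numFieldNormedType.Exports.

Set Implicit Arguments.
Unset Strict Implicit.
Unset Printing Implicit Defensive.

Local Open Scope classical_set_scope.
Local Open Scope ring_scope.

(** * Homomorphisms, containment, minimum degree, pigeonhole *)

Lemma hom_to_trans (G1 G2 G3 : graph) :
  hom_to G1 G2 -> hom_to G2 G3 -> hom_to G1 G3.
Proof. by move=> [f fh] [g gh]; exists (g \o f) => x y /fh /gh. Qed.

Lemma contains_card (G H : graph) : contains G H -> (#|H| <= #|G|)%N.
Proof. by move=> [f [/leq_card]]. Qed.

Lemma contains_trans (G1 G2 G3 : graph) :
  contains G1 G2 -> contains G2 G3 -> contains G1 G3.
Proof.
move=> [f [fi fh]] [g [gi gh]]; exists (f \o g); split; first exact: inj_comp.
by move=> x y /gh /fh.
Qed.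

Lemma leq_min_degree (G : graph) (m : nat) :
  (m <= #|G|)%N -> (forall x : G, m <= degree x)%N -> (m <= min_degree G)%N.
Proof.
move=> mG md; rewrite /min_degree; elim/big_ind: _ => // a b ma mb.
by rewrite leq_min ma mb.
Qed.

Lemma min_degree_leq (G : graph) (x : G) : (min_degree G <= degree x)%N.
Proof.
rewrite /min_degree; elim: (index_enum G) (mem_index_enum x) => //= y s IHs.
rewrite inE big_cons geq_min => /predU1P[->|/IHs->]; first by rewrite leqnn.
by rewrite orbT.
Qed.

(* Every element of [A] is [P]-related to some element of [K]; no function
   choosing it is needed. *)
Lemma pigeonhole_rel (T K : finType) (A : pred T) (P : T -> K -> bool) (t : nat) :
  (forall x, A x -> exists k, P x k) -> (#|K| * t < #|A|)%N ->
  exists k, (t < #|[pred x | P x k]|)%N.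
Proof.
move=> AP; apply: contraPP => noK; apply/negP; rewrite -leqNgt.
have leK k : (#|[pred x | P x k]| <= t)%N.
  by rewrite leqNgt; apply/negP => tk; apply: noK; exists k.
rewrite -sum_nat_const.
apply: (@leq_trans (\sum_(k in K) #|[pred x | P x k]|)%N); last first.
  by apply: leq_sum => k _; exact: leK.
under eq_bigr do rewrite -sum1_card big_mkcond.
rewrite exchange_big -sum1_card big_mkcond /=; apply: leq_sum => x _.
rewrite unfold_in; case: ifP => // /AP[k Pxk].
by rewrite (bigD1 k) //= inE Pxk.
Qed.

(** * Graph constructions *)

Lemma neq_sym (T : finType) : symmetric (fun x y : T => x != y).
Proof. by move=> x y; rewrite eq_sym. Qed.

Lemma neq_irr (T : finType) : irreflexive (fun x y : T => x != y).
Proof. by move=> x; rewrite eqxx. Qed.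

Definition complete_graph (T : finType) : graph :=
  Graph (@neq_sym T) (@neq_irr T).

Definition edgeless_graph (T : finType) : graph :=
  @Graph T (fun _ _ => false) (fun _ _ => erefl) (fun _ => erefl).

Definition join_adj (q : nat) (X : graph) : rel ('I_q * X) :=
  fun x y => (x.1 != y.1) || adj x.2 y.2.

Lemma join_adj_sym q X : symmetric (@join_adj q X).
Proof. by move=> x y; rewrite /join_adj eq_sym adj_sym. Qed.

Lemma join_adj_irr q X : irreflexive (@join_adj q X).
Proof. by move=> x; rewrite /join_adj eqxx adj_irr. Qed.

Definition join_power (q : nat) (X : graph) : graph :=
  Graph (@join_adj_sym q X) (@join_adj_irr q X).

Definition multipartite (q t : nat) : graph :=
  join_power q (edgeless_graph 'I_t).

Definition pad_adj (A : graph) (m : nat) : rel (A + 'I_m)%type := fun x y =>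
  match x, y with inl a, inl b => adj a b | _, _ => false end.

Lemma pad_adj_sym A m : symmetric (@pad_adj A m).
Proof. by move=> [a|i] [b|j] //=; rewrite adj_sym. Qed.

Lemma pad_adj_irr A m : irreflexive (@pad_adj A m).
Proof. by move=> [a|i] //=; rewrite adj_irr. Qed.

Definition pad (A : graph) (m : nat) : graph :=
  Graph (@pad_adj_sym A m) (@pad_adj_irr A m).

Definition descartes_adj (X : graph) (k : nat) :
    rel ((X * 'I_k) + {ffun X -> X * 'I_k} * X)%type := fun x y =>
  match x, y with
  | inl _, inl _ => false
  | inl s, inr p => injectiveb p.1 && (p.1 p.2 == s)
  | inr p, inl s => injectiveb p.1 && (p.1 p.2 == s)
  | inr p, inr q => (p.1 == q.1) && adj p.2 q.2
  end.

Lemma descartes_adj_sym X k : symmetric (@descartes_adj X k).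
Proof. by move=> [s|p] [s'|q] //=; rewrite eq_sym adj_sym. Qed.

Lemma descartes_adj_irr X k : irreflexive (@descartes_adj X k).
Proof. by move=> [s|p] //=; rewrite adj_irr andbF. Qed.

(* Blanche Descartes' construction: an independent set [X * 'I_k], and for
   every injection [f] of [X] into it a copy of [X] matched to it along [f]
   (non-injective [f] contribute unmatched copies). *)
Definition descartes (X : graph) (k : nat) : graph :=
  Graph (@descartes_adj_sym X k) (@descartes_adj_irr X k).

(** * Colourings, copies and degrees in these graphs *)

Lemma colorableP (G : graph) (k : nat) :
  reflect (hom_to G (complete_graph 'I_k)) (colorable G k).
Proof.
apply: (iffP existsP) => [[c /forallP cP]|[f fh]].
  by exists c => x y xy; move/forallP: (cP x) => /(_ y) /implyP; apply.
exists [ffun x => f x]; apply/forallP=> x; apply/forallP=> y; apply/implyP=> xy.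
by rewrite !ffunE; exact: fh.
Qed.

Lemma hom_complete_inj (T : finType) (G : graph) (f : complete_graph T -> G) :
  is_hom f -> injective f.
Proof.
move=> fh x y fxy; apply/eqP/negP => /negP xy.
by have := fh x y xy; rewrite fxy adj_irr.
Qed.

Lemma complete_contains (G : graph) (k : nat) :
  (#|G| <= k)%N -> contains (complete_graph 'I_k) G.
Proof.
move=> Gk; exists (fun x => widen_ord Gk (enum_rank x)); split.
  by move=> x y /(congr1 val) /= /ord_inj /enum_rank_inj.
move=> x y xy /=.
apply: contraTneq xy => /(congr1 val) /= /ord_inj /enum_rank_inj->.
by rewrite adj_irr.
Qed.

Lemma hom_complete_card (G : graph) (k : nat) :
  (#|G| <= k)%N -> hom_to G (complete_graph 'I_k).
Proof. by move=> /complete_contains[f [_ fh]]; exists f. Qed.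

(** Isolated vertices carry no adjacency condition, so they can go anywhere outside the image of
    [f]. *)
Lemma pad_contains (G A : graph) (m : nat) :
  contains G A -> (#|A| + m <= #|G|)%N -> contains G (pad A m).
Proof.
move=> [f [fi fh]] AmG.
have mC : (m <= #|[predC codom f]|)%N.
  by rewrite -(leq_add2l #|codom f|) cardC card_codom.
pose g (x : pad A m) : G := match x with
  inl a => f a | inr i => enum_val (widen_ord mC i) end.
have gC i : g (inr i) \notin codom f by exact: (enum_valP (widen_ord mC i)).
exists g; split=> [[a|i] [b|j]|[a|i] [b|j]] //=.
- by move/fi->.
- by move=> E; case/negP: (gC j); rewrite /= -E codom_f.
- by move=> E; case/negP: (gC i); rewrite /= E codom_f.
- by move=> /enum_val_inj/(congr1 val) /= /ord_inj ->.
- exact: fh.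
Qed.

Lemma contains_pad (A : graph) (m : nat) : contains (pad A m) A.
Proof. by exists inl; split=> // x y []. Qed.

Lemma card_pad (A : graph) (m : nat) : #|pad A m| = (#|A| + m)%N.
Proof. by rewrite card_sum card_ord. Qed.

Lemma card_join_power (q : nat) (X : graph) : #|join_power q X| = (q * #|X|)%N.
Proof. by rewrite card_prod card_ord. Qed.

Lemma degree_join_power (q : nat) (X : graph) (x : join_power q X) :
  degree x = (q.-1 * #|X| + degree x.2)%N.
Proof.
case: x => i x; rewrite /degree.
rewrite -[LHS]sum1_card -[X in (_ + X)%N]sum1_card big_mkcond /=.
rewrite -(pair_bigA _ (fun j y => if (j, y) \in [pred z | join_adj (i, x) z]
  then 1 else 0)%N) /= (bigD1 i) //= addnC; congr addn; last first.
  rewrite [RHS]big_mkcond; apply: eq_bigr => y _.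
  by rewrite !inE /join_adj /= eqxx.
under eq_bigr => j ji.
  under eq_bigr => y _ do rewrite inE /join_adj /= eq_sym ji /=.
  rewrite sum1_card.
  over.
rewrite sum_nat_const -[q in RHS]card_ord -(cardC1 i).
by congr (_ * _)%N; apply: eq_card.
Qed.

Lemma chromatic_number_pad_multipartite (r t m : nat) :
  (0 < r)%N -> (0 < t)%N -> chromatic_number (pad (multipartite r t) m) = r.
Proof.
move=> r0 t0; rewrite /chromatic_number; case: ex_minnP => k /colorableP Hk kmin.
apply/eqP; rewrite eqn_leq kmin /=; last first.
  apply/colorableP; exists (fun x : pad (multipartite r t) m =>
    match x with inl a => a.1 | inr _ => Ordinal r0 end : complete_graph 'I_r).
  by move=> [a|i] [b|j] //=; rewrite /join_adj orbF.
have Kr : hom_to (complete_graph 'I_r) (pad (multipartite r t) m).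
  exists (fun i => inl (i, Ordinal t0)) => i j ij /=.
  by rewrite /join_adj /= orbF.
have [f /hom_complete_inj /leq_card] := hom_to_trans Kr Hk.
by rewrite !card_ord.
Qed.

(** * [C_4]-free graphs of large chromatic number, and their joins *)

Definition C4_free (X : graph) : Prop := forall x x' y y' : X,
  x != x' -> y != y' -> adj x y -> adj x y' -> adj x' y -> adj x' y' -> False.

(** A vertex of a copy has at most one neighbour in the independent set, and a vertex [s] of that
    set at most one in each copy, by injectivity. So no 4-cycle meets the independent set ([key]),
    and any other lies inside one copy of [X]. *)
Lemma C4_free_descartes (X : graph) (k : nat) : C4_free X -> C4_free (descartes X k).
Proof.
pose D := descartes X k.
have key s p (y' x' : D) : adj (inl s : D) (inr p) -> adj (inl s : D) y' ->
    (inr p : D) != y' -> (inl s : D) != x' -> adj x' (inr p : D) -> adj x' y' ->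
    False.
  case: y' => // -[g w]; case: p => f v /= /andP[/injectiveP fi /eqP <-].
  move=> /andP[/injectiveP gi /eqP gw] neq; case: x' => [s'|[h u]] /=.
    by move=> ss /andP[_ /eqP E] _; rewrite E eqxx in ss.
  move=> _ /andP[/eqP hf _] /andP[/eqP hg _]; move: neq gw; rewrite -hg hf.
  by move=> neq /fi E; rewrite E eqxx in neq.
move=> X4 x x' y y' xx' yy' xy xy' x'y x'y'.
case: x y x' y' xx' yy' xy xy' x'y x'y' => [s|[f v]] [s'|[g w]] // x' y'.
- move=> xx' yy' xy xy' x'y x'y'; exact: (key _ _ _ _ xy xy' yy' xx' x'y x'y').
- move=> xx' yy' xy xy' x'y x'y'.
  apply: (key s' (f, v) x' y'); rewrite // 1?adj_sym //.
case: x' y' => [s|[h u]] [s'|[e z]] // xx' yy' xy xy' x'y x'y'.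
- apply: (key s (g, w) (inr (e, z)) (inr (f, v))); rewrite // 1?adj_sym //.
- apply: (key s' (f, v) (inr (h, u)) (inr (g, w))); rewrite // 1?adj_sym //.
move: xy xy' x'y x'y' xx' yy' => /= /andP[/eqP fg vw] /andP[/eqP fe vz].
move=> /andP[/eqP hg uw] /andP[/eqP he uz]; subst g e h => xx' yy'.
apply: (X4 v u w z) => //.
- by apply: contraNneq xx' => ->.
- by apply: contraNneq yy' => ->.
Qed.

Lemma descartes_no_isolated (X : graph) (k : nat) : (0 < #|X|)%N ->
  (forall x : X, exists y, adj x y) ->
  forall x : descartes X k, exists y, adj x y.
Proof.
move=> /card_gt0P[x0 _] Xd [[x i]|[f v]]; last first.
  by have [w vw] := Xd v; exists (inr (f, w)); rewrite /= eqxx.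
(* The injection of [X] onto level [i] matches [x] to [(x, i)]. *)
exists (inr ([ffun y => (y, i)], x)) => /=; rewrite ffunE eqxx andbT.
by apply/injectiveP => y z; rewrite !ffunE => -[].
Qed.

(** By pigeonhole some colour [a] occurs on [#|X|] vertices of the independent set. The copy of [X]
    matched to these avoids [a], so [k] colours would suffice for [X]. *)
Lemma descartes_not_colorable (X : graph) (k : nat) : (0 < #|X|)%N ->
  ~~ colorable X k -> ~~ colorable (descartes X k.+1) k.+1.
Proof.
move=> X0; apply: contra => /colorableP[c ch].
have [a] : exists a, (#|X|.-1 < #|[pred s | c (inl s) == a]|)%N.
  apply: (@pigeonhole_rel _ _ predT) => [s _|]; first by exists (c (inl s)).
  rewrite (@eq_card _ _ predT) // card_prod card_ord mulnC ltn_pmul2r //.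
  by rewrite prednK.
rewrite prednK // => Xa.
pose f := [ffun x : X => enum_val (widen_ord Xa (enum_rank x))].
have fi : injectiveb f.
  apply/injectiveP => x y; rewrite !ffunE.
  by move=> /enum_val_inj/(congr1 val) /= /ord_inj/enum_rank_inj.
have fa x : c (inl (f x)) = a.
  by rewrite ffunE; have := enum_valP (widen_ord Xa (enum_rank x)); rewrite inE => /eqP.
have ca x : a != c (inr (f, x)).
  by rewrite -(fa x); apply: ch; rewrite /= fi eqxx.
have cl x : {j | c (inr (f, x)) = lift a j}.
  by have [j E _] := unlift_some (ca x); exists j.
apply/colorableP; exists (fun x => sval (cl x)) => x y xy /=.
have : adj (c (inr (f, x))) (c (inr (f, y))) by apply: ch; rewrite /= eqxx.
case: (cl x) (cl y) => i /= Ei [j /= Ej].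
by rewrite Ei Ej (inj_eq (@lift_inj _ a)).
Qed.

Lemma C4_free_high_chromatic (k : nat) : exists X : graph,
  [/\ C4_free X, (0 < #|X|)%N, forall x : X, exists y, adj x y
    & ~~ colorable X k].
Proof.
elim: k => [|k [X [X4 X0 Xd Xk]]]; last first.
  exists (descartes X k.+1); split; first exact: C4_free_descartes.
  - by rewrite card_sum card_prod card_ord; case: #|X| X0.
  - exact: descartes_no_isolated.
  - exact: descartes_not_colorable.
(* A single edge, not a single vertex, so that no vertex is isolated. *)
exists (complete_graph bool); split=> [[] [] [] []||b|] //.
- by rewrite card_bool.
- by exists (~~ b); case: b.
- by apply/existsP => -[c _]; case: (c true).
Qed.

(* Each of the [q.+1] classes puts two vertices in the same copy of [X], and
   two classes do so in the same copy, producing a 4-cycle there. *)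
Lemma join_power_multipartite_free (q : nat) (X : graph) :
  C4_free X -> ~ contains (join_power q X) (multipartite q.+1 q.+1).
Proof.
move=> X4 [f [fi fh]].
have two i : exists a, (1 < #|[pred j | (f (i, j)).1 == a]|)%N.
  apply: (@pigeonhole_rel _ _ predT) => [j _|]; first by exists (f (i, j)).1.
  by rewrite (@eq_card _ _ predT) // !card_ord muln1.
have [a /card_gt1P[i [i' []]]] : exists a : 'I_q,
    (1 < #|[pred i | (1 < #|[pred j | (f (i, j)).1 == a]|)%N]|)%N.
  apply: (@pigeonhole_rel _ _ predT) => [i _|]; first exact: two.
  by rewrite (@eq_card _ _ predT) // !card_ord muln1.
rewrite !inE => /card_gt1P[j [k [ja ka jk]]] /card_gt1P[j' [k' [ja' ka' jk']]] ii'.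
move: ja ka ja' ka'; rewrite !inE => /eqP ja /eqP ka /eqP ja' /eqP ka'.
have ne p p' : p != p' -> (f p).1 = a -> (f p').1 = a -> (f p).2 != (f p').2.
  move=> pp' E E'; apply: contraNneq pp' => E2; apply/eqP/fi.
  by move: (f p) (f p') E E' E2 => [? ?] [? ?] /= -> -> ->.
have ad l l' : (f (i, l)).1 = a -> (f (i', l')).1 = a ->
    adj (f (i, l)).2 (f (i', l')).2.
  move=> E E'; have /fh : adj ((i, l) : multipartite _ _) (i', l').
    by rewrite /= /join_adj /= ii'.
  by rewrite /= /join_adj E E' eqxx.
apply: (X4 (f (i, j)).2 (f (i, k)).2 (f (i', j')).2 (f (i', k')).2); try exact: ad.
- by apply: ne => //; apply: contraNneq jk => -[->].
- by apply: ne => //; apply: contraNneq jk' => -[->].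
Qed.

(** * The Erdos-Stone theorem in minimum degree form *)

(* Greedy choice of one more class: by double counting the non-adjacent pairs,
   a positive proportion of the vertices have [t] neighbours in each class of
   a copy of [multipartite q.+1 (2 * d * t)], and [t] of these vertices have
   the same ones. *)
Lemma erdos_stone_min_degree (q t d : nat) : (0 < d)%N -> (0 < t)%N ->
  exists N, forall G : graph, (N <= #|G|)%N ->
    (forall x : G, d * (q * #|[pred y | ~~ adj x y]|) <= d.-1 * #|G|)%N ->
    contains G (multipartite q.+1 t).
Proof.
move=> d0; elim: q t => [|q IHq] t t0.
  exists t => G tG _; rewrite -[t]card_ord in tG.
  pose f (x : multipartite 1 t) : G := enum_val (widen_ord tG (enum_rank x.2)).
  exists f; split=> [[i x] [j y]|[i x] [j y]].
    move=> /enum_val_inj/(congr1 val) /= /ord_inj/enum_rank_inj /= ->.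
    by rewrite (ord1 i) (ord1 j).
  by rewrite /= /join_adj /= (ord1 i) (ord1 j).
have T0 : (0 < 2 * d * t)%N by rewrite !muln_gt0 d0 t0.
have [N IHN] := IHq _ T0; set T := (2 * d * t)%N in T0 IHN.
(* [K] counts the maps picking [t] vertices, possibly repeated, in each class; the order bound will
   give more than [K * t.-1] good vertices. *)
pose K := #|{ffun 'I_q.+1 * 'I_t -> 'I_T}|.
exists (N + (2 * d).-1 * (K * t) + 1)%N => G NG Gd.
have [|x|f [fi fh]] := IHN G.
  by apply: leq_trans NG; rewrite -addnA leq_addr.
  by apply: leq_trans (Gd x); rewrite leq_mul2l leq_mul2r leqnSn !orbT.
pose ok (y : G) (h : {ffun 'I_q.+1 * 'I_t -> 'I_T}) :=
  [forall i, injectiveb (fun j => h (i, j))]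
  && [forall p, adj (f (p.1, h p)) y].
pose good (y : G) := [forall i, (t <= #|[pred j | adj (f (i, j)) y]|)%N].
have good_ok y : good y -> exists h, ok y h.
  move=> /forallP yt.
  exists [ffun p : 'I_q.+1 * 'I_t => enum_val (widen_ord (yt p.1) p.2)].
  apply/andP; split; apply/forallP.
    move=> i; apply/injectiveP => j j'; rewrite !ffunE /=.
    by move=> /enum_val_inj/(congr1 val) /= /ord_inj.
  by case=> i j; rewrite ffunE /=; exact: (enum_valP (widen_ord (yt i) j)).
have nonadj_bad y : ~~ good y ->
    (T - t <= #|[pred p : 'I_q.+1 * 'I_T | ~~ adj (f p) y]|)%N.
  move=> /forallPn[i]; rewrite -ltnNge => it.
  have := cardC [pred j | adj (f (i, j)) y]; rewrite card_ord => cT.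
  apply: (@leq_trans #|[predC [pred j | adj (f (i, j)) y]]|).
    by rewrite leq_subLR -[leqLHS]cT leq_add2r ltnW.
  rewrite -(@fintype.card_image _ _ (fun j => (i, j))); last by move=> ? ? [].
  by apply/subset_leq_card/fintype.subsetP => _ /fintype.imageP[j ja ->].
(* Count the non-adjacent pairs of a copy vertex and a bad vertex from both sides; the number [q.+1]
   of classes cancels. *)
have count_nonadj : (d * (#|[predC good]| * (T - t)) <= T * (d.-1 * #|G|))%N.
  rewrite -(@leq_pmul2l q.+1) //.
  have : (\sum_(p : 'I_q.+1 * 'I_T) d * (q.+1 * #|[pred y | ~~ adj (f p) y]|)
      <= \sum_(p : 'I_q.+1 * 'I_T) d.-1 * #|G|)%N by apply: leq_sum.
  rewrite sum_nat_const card_prod !card_ord -!big_distrr /= -mulnA.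
  apply: leq_trans; rewrite mulnCA !leq_pmul2l //.
  under eq_bigr do rewrite -sum1_card big_mkcond.
  rewrite exchange_big /= -sum_nat_const big_mkcond; apply: leq_sum => y _.
  case: ifP => // /nonadj_bad /leq_trans; apply.
  by rewrite -sum1_card big_mkcond.
(* With [T = 2dt], at most [(2d - 2) / (2d - 1)] of all vertices are bad, so at least [1 / (2d - 1)]
   of them are good. *)
have many_good : (K * t.-1 < #|good|)%N.
  have GC := cardC good.
  have bad_le : ((2 * d).-1 * #|[predC good]| <= 2 * d.-1 * #|G|)%N.
    rewrite -(@leq_pmul2l (d * t)); last by rewrite muln_gt0 d0.
    move: count_nonadj; rewrite /T.
    have -> : (2 * d * t - t = (2 * d).-1 * t)%N by rewrite -subn1 mulnBl mul1n.
    by apply: etrans; congr leq; lia.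
  have : (#|G| <= (2 * d).-1 * #|good|)%N.
    rewrite -(leq_add2r ((2 * d).-1 * #|[predC good]|)) -mulnDr GC.
    have -> : ((2 * d).-1 * #|G| = #|G| + 2 * d.-1 * #|G|)%N.
      by rewrite -mulSn; congr muln; lia.
    by rewrite leq_add2l.
  move=> Gg; rewrite -(@ltn_pmul2l (2 * d).-1); last lia.
  apply: leq_trans Gg; apply: leq_trans NG; rewrite addn1 ltnS.
  by apply: leq_trans (leq_addl _ _); rewrite !leq_mul2l leq_pred !orbT.
have [h] := pigeonhole_rel good_ok many_good.
rewrite prednK // => th.
have hP (j : 'I_t) : ok (enum_val (widen_ord th j)) h.
  exact: (enum_valP (widen_ord th j)).
pose v (j : 'I_t) := enum_val (widen_ord th j).
have hi i : injective (fun j => h (i, j)).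
  case/andP: (hP (Ordinal t0)) => /forallP /(_ i) /injectiveP hi _; exact: hi.
have va p j : adj (f (p.1, h p)) (v j).
  by case/andP: (hP j) => _ /forallP /(_ p).
have vf p j : f (p.1, h p) != v j.
  by apply: contraTneq (va p j) => ->; rewrite adj_irr.
pose g (x : multipartite q.+2 t) : G :=
  if unlift ord0 x.1 is Some i then f (i, h (i, x.2)) else v x.2.
exists g; split=> [[a j] [b k]|[a j] [b k]]; rewrite /g /=.
  case: unliftP => [i|] ->; case: unliftP => [i'|] ->.
  - move/fi => [<- /hi ->] //.
  - by move/eqP; rewrite (negPf (vf (i, j) k)).
  - by move/esym/eqP; rewrite (negPf (vf (i', k) j)).
  - by move=> /enum_val_inj/(congr1 val) /= /ord_inj ->.
rewrite /join_adj orbF /=; case: unliftP => [i|] ->; case: unliftP => [i'|] -> //.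
- by move=> ii; apply: fh; rewrite /= /join_adj /= orbF -(inj_eq (@lift_inj _ ord0)).
- by move=> _; exact: (va (i, j)).
- by move=> _; rewrite adj_sym; exact: (va (i', k)).
Qed.

(** * Bounds on [delta_hom] of padded multipartite graphs *)

Lemma delta_hom_pad_multipartite_le (R : realType) (q t d : nat) :
  (0 < q)%N -> (0 < d)%N -> (0 < t)%N ->
  exists N, forall m, (N < q.+1 * t + m)%N ->
    delta_hom R (pad (multipartite q.+1 t) m)
      <= 1 - q%:R^-1 + (q * d)%:R^-1.
Proof.
move=> q0 d0 t0; have [N NP] := erdos_stone_min_degree q d0 t0; exists N => m Nm.
set A := multipartite q.+1 t; set gamma : R := 1 - _ + _.
have cA : #|A| = (q.+1 * t)%N by rewrite card_join_power card_ord.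
have q0R : 0 < q%:R :> R by rewrite ltr0n.
have d0R : 0 < d%:R :> R by rewrite ltr0n.
have gammaE : gamma * (q%:R * d%:R) = q%:R * d%:R - d%:R + 1.
  by rewrite /gamma natrM; field; rewrite !gt_eqF.
apply: ge_inf; first by exists 0 => g [].
split.
  rewrite addr_ge0 // ?invr_ge0 // subr_ge0 invf_le1 // ler1n //.
exists (complete_graph 'I_(q.+1 * t + m).-1); split.
  by move/contains_card; rewrite card_pad cA card_ord; lia.
move=> G GH Gd; case: (leqP #|G| (q.+1 * t + m).-1) => [|Glarge].
  exact: hom_complete_card.
case: GH; apply: pad_contains; last by rewrite cA; lia.
(* The degree condition leaves [x] at most [(1 - gamma) * #|G|] non-neighbours, itself included, and
   [1 - gamma = (d - 1) / (q * d)]. *)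
apply: NP => [|x]; first lia.
have := cardC [pred y | adj x y]; rewrite -/(degree x) => degC.
have {Gd} Gx : gamma * #|G|%:R <= (degree x)%:R.
  by apply: le_trans Gd _; rewrite ler_nat min_degree_leq.
have degCR : (degree x)%:R + #|[pred y | ~~ adj x y]|%:R = #|G|%:R :> R.
  by rewrite -natrD degC.
rewrite -(ler_nat R) !natrM -subn1 natrB //.
have : gamma * (q%:R * d%:R) * #|G|%:R <= (q%:R * d%:R) * (degree x)%:R.
  by rewrite mulrAC mulrC ler_pM2l // mulr_gt0.
rewrite gammaE -degCR; lra.
Qed.

(* [complete_graph 'I_k], with [k.+1] the order of the padded graph, is free of
   it for want of vertices, so it maps to the target; this embeds
   [multipartite] in the target, which therefore has at most [k] vertices.
   Hence all graphs mapping to it are [k]-colorable. *)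
Lemma lt_delta_hom_pad_multipartite (R : realType) (q m : nat) :
  (0 < q)%N -> (0 < m)%N ->
  1 - q%:R^-1 < delta_hom R (pad (multipartite q.+1 q.+1) m).
Proof.
move=> q0 m0; set A := multipartite q.+1 q.+1.
have cA : #|A| = (q.+1 * q.+1)%N by rewrite card_join_power card_ord.
pose k := (q.+1 * q.+1 + m).-1.
have [X [X4 X0 Xd Xk]] := C4_free_high_chromatic k.
have X1 : (1 < #|X|)%N.
  have /card_gt0P[x _] := X0; have [y xy] := Xd x.
  apply/card_gt1P; exists x, y; split=> //.
  by apply: contraTneq xy => ->; rewrite adj_irr.
have q0R : 0 < q%:R :> R by rewrite ltr0n.
have X0R : 0 < #|X|%:R :> R by rewrite ltr0n.
(* The middle term is [((q - 1) * #|X| + 1) / (q * #|X|)], a lower bound for the relative minimum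
   degree of [join_power q X]. *)
apply: (@lt_le_trans _ _ (1 - q%:R^-1 + (q * #|X|)%:R^-1)).
  by rewrite ltrDl invr_gt0 natrM mulr_gt0.
apply: lb_le_inf.
  by apply: (has_inf_hom_bounds R _).1; rewrite card_pad; lia.
move=> gamma [gamma0 [F [FH FP]]]; rewrite leNgt; apply/negP => gamma_lt.
have gamma_lt' : gamma * (q%:R * #|X|%:R) < (q%:R - 1) * #|X|%:R + 1.
  have -> : (q%:R - 1) * #|X|%:R + 1 =
      (1 - q%:R^-1 + (q * #|X|)%:R^-1) * (q%:R * #|X|%:R) :> R.
    by rewrite natrM; field; rewrite !gt_eqF.
  by rewrite ltr_pM2r // mulr_gt0.
have KF : contains F (complete_graph 'I_k).
  have [||f fh] := FP (complete_graph 'I_k); last first.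
  - by exists f; split=> //; exact: hom_complete_inj.
  - apply: (@le_trans _ _ (k.-1)%:R); last first.
      rewrite ler_nat; apply: leq_min_degree; first by rewrite card_ord leq_pred.
      move=> i; rewrite /degree -[k in k.-1]card_ord -(cardC1 i).
      by apply/subset_leq_card/fintype.subsetP => j; rewrite !inE eq_sym.
    rewrite card_ord -subn1 natrB; last by rewrite /k; lia.
    (* As [2 <= #|X|] and [2 * q <= k], [gamma] is at most [1 - 1/(2q) <= 1 - 1/k], the relative
       degree of the complete graph. *)
    have kq : 2 * q%:R <= k%:R :> R by rewrite -natrM ler_nat /k; nia.
    have X2 : 2 <= #|X|%:R :> R by rewrite ler_nat.
    have k0 : 0 < k%:R :> R by lra.
    have gq : gamma * (2 * q%:R) <= 2 * q%:R - 1.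
      rewrite -(ler_pM2r X0R); nra.
    rewrite -(@ler_pM2r _ (2 * q%:R)); last lra.
    nra.
  - by move/contains_card; rewrite card_pad cA card_ord /k; lia.
have Fk : (#|F| <= k)%N.
  rewrite leqNgt; apply/negP => kF; apply: FH.
  apply: pad_contains; last by rewrite cA; move: kF; rewrite /k; lia.
  by apply: contains_trans KF _; apply: complete_contains; rewrite cA /k; lia.
case/negP: Xk; apply/colorableP; apply: hom_to_trans (hom_complete_card Fk).
have XJ : hom_to X (join_power q X).
  by exists (fun x => (Ordinal q0, x)) => x y xy; rewrite /= /join_adj xy orbT.
apply: (hom_to_trans XJ); apply: FP.
  move=> /contains_trans /(_ (contains_pad _ _)).
  exact: join_power_multipartite_free.
apply: (@le_trans _ _ (q.-1 * #|X| + 1)%:R).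
  by rewrite card_join_power natrD !natrM -subn1 natrB // ltW.
rewrite ler_nat; apply: leq_min_degree.
  by rewrite card_join_power; nia.
move=> x; rewrite degree_join_power leq_add2l.
by have [y xy] := Xd x.2; apply/card_gt0P; exists y.
Qed.

(** * Accumulation at [1 - 1/q], where [r = q + 1] *)

Theorem theorem1p3 (R : realType) (r : nat) (hr : (3 <= r)%N) :
  limit_point (Delta_hom R r) ((r%:R - 2) / (r%:R - 1)).
Proof.
case: r hr => // q q2; have q0 : (0 < q)%N by lia.
have q0R : 0 < q%:R :> R by rewrite ltr0n.
have -> : (q.+1%:R - 2) / (q.+1%:R - 1) = 1 - q%:R^-1 :> R.
  by rewrite -natr1; field; rewrite ?addrK gt_eqF.
move=> U /nbhs_ballP[e /= e0 eU].
(* [d] exceeds [1/e], so the upper bound is within [e] of the limit. *)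
pose d := (Num.truncn e^-1).+1.
have dlt : (q * d)%:R^-1 < e.
  rewrite -[e]invrK ltf_pV2 ?posrE ?invr_gt0 // ?ltr0n ?muln_gt0 ?q0 //.
  apply: (@lt_le_trans _ _ d%:R); first by rewrite truncnS_gt.
  by rewrite ler_nat leq_pmull.
have [//|//|//|N NP] := @delta_hom_pad_multipartite_le R q q.+1 d.
have up := NP N.+1 ltac:(lia).
(* Strictness here makes the value differ from the limit. *)
have lo := @lt_delta_hom_pad_multipartite R q N.+1 q0 isT.
set H := pad _ _ in up lo.
exists (delta_hom R H); split; first by rewrite gt_eqF.
  by exists H; split=> //; exact: chromatic_number_pad_multipartite.
apply: eU; rewrite /ball /= ltr_distlC; apply/andP; split; lra.
Qed.
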